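(* Let $N\in\mathbb{N}$ and $\lambda\in\mathbb{C}$. Then, as differential operators $C^\infty(\mathbb{R}^n)\to C^\infty(\mathbb{R}^{n-1})$, $$D^{BS}_{2N}(\lambda)=(-2)^{N}\Big(\lambda-\frac n2-2N\Big)_N(2N-1)!!\,D_{2N}(n-\lambda),$$ $$D^{BS}_{2N+1}(\lambda)=(-2)^{N+1}\Big(\lambda-\frac n2-2N-1\Big)_{N+1}(2N+1)!!\,D_{2N+1}(n-\lambda).$$
   Context: Let $n\ge2$. $(a)_m=a(a+1)\cdots(a+m-1)$ is the Pochhammer symbol, $(a)_0=1$. $\iota:\mathbb{R}^{n-1}\to\mathbb{R}^n$, $x'\mapsto(x',0)$, and $\iota^*$ is restriction of functions to $x_n=0$. $\Delta=\sum_{k=1}^n\partial_k^2$, $\Delta'=\sum_{k=1}^{n-1}\partial_k^2$, and $$P(\lambda)=x_n\Delta-(2\lambda-n-2)\partial_n.$$ The Bernstein-Sato family for functions is $$D^{BS}_N(\lambda)=\iota^*P(\lambda-N+1)\circ\cdots\circ P(\lambda-1)\circ P(\lambda)$$ ($N$ factors). The conformal symmetry breaking differential operators on functions are $$D_{2N}(\lambda)=\sum_{k=0}^Na_k^{(N)}(-\lambda)(\Delta')^k\iota^*\partial_n^{2N-2k},\qquad D_{2N+1}(\lambda)=\sum_{k=0}^Nb_k^{(N)}(-\lambda)(\Delta')^k\iota^*\partial_n^{2N-2k+1},$$ where $$a_j^{(N)}(\lambda)=\frac{(-2)^{N-j}N!}{j!(2N-2j)!}\prod_{k=j}^{N-1}(2\lambda-4N+2k+n+1),\qquad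 b_j^{(N)}(\lambda)=\frac{(-2)^{N-j}N!}{j!(2N-2j+1)!}\prod_{k=j}^{N-1}(2\lambda-4N+2k+n-1)$$ (empty products equal $1$). *)

(* Defs.v *)
From HB Require Import structures.
From mathcomp Require Import all_boot all_order all_algebra.
From mathcomp Require Import all_classical all_reals all_analysis.
From mathcomp Require Import complex.

Set Implicit Arguments.
Unset Strict Implicit.
Unset Printing Implicit Defensive.
Import Order.TTheory GRing.Theory Num.Theory.
Import numFieldNormedType.Exports.

Local Open Scope ring_scope.
Local Open Scope complex_scope.

(* R^d is 'rV[R]_d and functions are complex valued.  MathComp-Analysis does
   not provide R[i] with the structure of a normed space over R, so real
   derivatives of complex functions are taken on real and imaginary parts. *)

Section Smooth.
Context {R : realType} {d : nat}.
Implicit Types (f : 'rV[R]_d -> R[i]) (i : 'I_d).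

Definition re_part f : 'rV[R]_d -> R := fun x => complex.Re (f x).
Definition im_part f : 'rV[R]_d -> R := fun x => complex.Im (f x).

(* The value 'D_v g x is meaningful only where g is derivable along v; all
   operators below are only compared on smooth functions. *)
Definition partial i f : 'rV[R]_d -> R[i] := fun x =>
  'D_(delta_mx 0 i) (re_part f) x +i* 'D_(delta_mx 0 i) (im_part f) x.

(* C^oo: every iterated partial derivative exists and is continuous; the
   derivative indexed by s = [:: i1; ..; ik] is d_i1 (.. (d_ik f)). *)
Definition smooth f : Prop := forall s : seq 'I_d,
  let g := foldr partial f s in
  [/\ continuous (re_part g), continuous (im_part g)
    & forall i x, derivable (re_part g) x (delta_mx 0 i) /\
                  derivable (im_part g) x (delta_mx 0 i)].

Definition laplacian f : 'rV[R]_d -> R[i] := fun x =>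
  \sum_(i < d) partial i (partial i f) x.

End Smooth.

Section Operators.
Context {R : realType} {m : nat}.
Implicit Types (lambda : R[i]) (f : 'rV[R]_m.+1 -> R[i]).

(* The ambient dimension is n = m.+1; the last coordinate x_n has index
   ord_max, and Delta' is the laplacian on 'rV[R]_m. *)
Local Notation n := (m.+1%:R : R[i]).

Definition embed (x : 'rV[R]_m) : 'rV[R]_m.+1 :=
  \row_(i < m.+1) (if unlift ord_max i is Some j then x 0 j else 0).

Definition restrict f : 'rV[R]_m -> R[i] := fun x => f (embed x).

Definition Pop lambda f : 'rV[R]_m.+1 -> R[i] := fun x =>
  (x 0 ord_max)%:C * laplacian f x
  - (2 * lambda - n - 2) * partial ord_max f x.

(* P(lambda - N + 1) o ... o P(lambda - 1) o P(lambda), P(lambda) acting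
   first. *)
Fixpoint Pchain (N : nat) lambda f : 'rV[R]_m.+1 -> R[i] :=
  if N is N'.+1 then Pop (lambda - N'%:R) (Pchain N' lambda f) else f.

Definition DBS (N : nat) lambda f : 'rV[R]_m -> R[i] :=
  restrict (Pchain N lambda f).

Definition coef_a (N j : nat) lambda : R[i] :=
  (-2) ^+ (N - j) * N`!%:R / (j`! * (2 * N - 2 * j)`!)%:R *
  \prod_(j <= k < N) (2 * lambda - 4 * N%:R + 2 * k%:R + n + 1).

Definition coef_b (N j : nat) lambda : R[i] :=
  (-2) ^+ (N - j) * N`!%:R / (j`! * (2 * N - 2 * j + 1)`!)%:R *
  \prod_(j <= k < N) (2 * lambda - 4 * N%:R + 2 * k%:R + n - 1).

(* Deven N and Dodd N are the operators of order 2N and 2N+1. *)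
Definition Deven (N : nat) lambda f : 'rV[R]_m -> R[i] := fun x =>
  \sum_(k < N.+1) coef_a N k (- lambda) *
    iter k laplacian (restrict (iter (2 * N - 2 * k) (partial ord_max) f)) x.

Definition Dodd (N : nat) lambda f : 'rV[R]_m -> R[i] := fun x =>
  \sum_(k < N.+1) coef_b N k (- lambda) *
    iter k laplacian
      (restrict (iter (2 * N - 2 * k + 1) (partial ord_max) f)) x.

(* Equality of operators from C^oo(R^n) to C^oo(R^(n-1)), including the fact
   that smooth functions are mapped to smooth functions. *)
Definition eq_smooth_op (A B : ('rV[R]_m.+1 -> R[i]) -> ('rV[R]_m -> R[i])) :
    Prop :=
  forall f, smooth f -> [/\ smooth (A f), smooth (B f) & A f = B f].

End Operators.

Definition pochhammer {K : pzRingType} (a : K) (k : nat) : K :=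
  \prod_(i < k) (a + i%:R).

(* Since 2 * 0 - 1 = 0 in nat, (2N-1)!! at N = 0 is double_fact 0 = 1, in
   agreement with the convention (-1)!! = 1. *)
Fixpoint double_fact (k : nat) : nat :=
  if k is k'.+2 then (k * double_fact k')%N else 1%N.

(* Main.v *)
Require Import Defs.
From mathcomp Require Import all_boot all_order all_algebra.
From mathcomp Require Import all_classical all_reals all_analysis.
From mathcomp Require Import complex.
From mathcomp Require Import ring zify.

Set Implicit Arguments.
Unset Strict Implicit.
Unset Printing Implicit Defensive.
Import Order.TTheory GRing.Theory Num.Theory.
Import numFieldNormedType.Exports.

Local Open Scope ring_scope.
Local Open Scope complex_scope.

(** Why the theorem is true.  For a function f on the ambient space put
    [jet j k f], the function obtained by differentiating f k times in the
    normal direction, restricting to the hyperplane x_n = 0, and applying the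
    tangential Laplacian j times.  Both families of operators are combinations
    of jets, so the statement reduces to an identity between coefficients.

    The Leibniz rule gives the jet of P(mu) f.  On the hyperplane the term that
    still carries the factor x_n vanishes, one normal derivative falling on x_n
    contributes k times the jet of the full Laplacian of f at normal order
    k - 1, and the full Laplacian is the tangential one plus the second normal
    derivative.  Hence ([jet_Pop])

      jet j k (P(mu) f)
        = k jet (j+1) (k-1) f + (k + n + 2 - 2 mu) jet j (k+1) f.

    Peeling off the innermost factor P(lambda) of the chain turns this into the
    recursion [bs_coef] for the coefficients of the jets ([DBS_jet]), where
    lambda enters only through A = 2 lambda - n - 2, and A drops by 2 at each
    step.  The recursion has the closed solution ([bs_coefE])

      M! / (k! (M-2k)! 2^k)  times the product of (2M - 2 - i - A)
      over all i < M other than the odd i < 2k.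

    The factors with even i are common to all k: they make up the Pochhammer
    symbol, up to a power of -2.  Those with odd i are, up to sign, the products
    in the coefficients a and b ([bs_coef_even], [bs_coef_odd]).

    The analytic input is that second partial derivatives commute ([clairaut]),
    needed to move normal derivatives through the Laplacian, and that all the
    operators preserve smoothness ([smooth_algebra_smooth],
    [smooth_restrict]). *)

(** * Symmetry of second derivatives *)

Section Clairaut.
Context {R : realType} {V : normedModType R}.
Implicit Types (f : V -> R) (x u v : V).

Lemma is_derive_line f x u t : derivable f (t *: u + x) u ->
  is_derive t (1 : R) (fun s : R => f (s *: u + x)) ('D_u f (t *: u + x)).
Proof.
have E : (fun h : R => h^-1 *: (((fun s : R => f (s *: u + x)) \o shift t) (h *: (1:R))
     - f (t *: u + x))) =
  (fun h : R => h^-1 *: ((f \o shift (t *: u + x)) (h *: u) - f (t *: u + x))).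
  apply/funext => h /=; congr (_ *: (f _ - _)).
  by rewrite [h *: 1]mulr1 scalerDl addrA.
by move=> fD; split; rewrite /derivable /derive E.
Qed.

Lemma MVT_line f x u h : 0 < h -> (forall y, derivable f y u) ->
  exists2 c, 0 < c < h & f (h *: u + x) - f x = h * 'D_u f (c *: u + x).
Proof.
move=> h0 fD.
pose g := fun s : R => f (s *: u + x).
have gD s : is_derive s (1 : R) g ('D_u f (s *: u + x)) by exact: is_derive_line.
have gc : {within `[0, h], continuous g}%classic.
  by apply: derivable_within_continuous => s _; exact: ex_derive.
have [c] := MVT h0 (fun s _ => gD s) gc.
rewrite in_itv /= => c0h; rewrite /g scale0r add0r subr0 => E.
by exists c => //; rewrite E mulrC.
Qed.

(** Applying the mean value theorem first to the increment of f in direction v,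
    as a function along u, and then to the derivative of f along u. *)
Lemma second_difference f x u v h : 0 < h ->
  (forall y, derivable f y u) -> (forall y, derivable ('D_u f) y v) ->
  exists c d, [/\ 0 < c < h, 0 < d < h &
    f (h *: v + (h *: u + x)) - f (h *: u + x) - (f (h *: v + x) - f x) =
    h * (h * 'D_v ('D_u f) (d *: v + (c *: u + x)))].
Proof.
move=> h0 fu fuv.
pose g y := f (h *: v + y) - f y.
have gD y : is_derive y u g ('D_u f (h *: v + y) - 'D_u f y).
  apply: is_deriveB; last exact/derivableP.
  have E : (fun k : R => k^-1 *: (((fun y => f (h *: v + y)) \o shift y) (k *: u)
     - f (h *: v + y))) =
    (fun k : R => k^-1 *: ((f \o shift (h *: v + y)) (k *: u) - f (h *: v + y))).
    by apply/funext => k /=; rewrite addrCA.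
  by split; [rewrite /derivable E; exact: fu|rewrite /derive E].
have [c c0h] := @MVT_line g x u h h0 (fun y => @ex_derive _ _ _ _ _ _ _ (gD y)).
rewrite (@derive_val _ _ _ _ _ _ _ (gD _)) => E.
have [d d0h E2] := @MVT_line ('D_u f) (c *: u + x) v h h0 fuv.
by exists c, d; split=> //; rewrite -E2 -E.
Qed.

(** Continuity reduces an equality at x to one between values at two points
    that may differ, as long as both can be taken arbitrarily close to x. *)
Lemma eq_of_close (F G : V -> R) x (M : R) :
  {for x, continuous F} -> {for x, continuous G} -> 0 < M ->
  (forall h, 0 < h -> exists p q,
    [/\ `|p - x| <= h * M, `|q - x| <= h * M & F p = G q]) ->
  F x = G x.
Proof.
move=> cF cG M0 close.
apply/eqP; rewrite -subr_eq0 -normr_le0; apply/ler_addgt0Pr => e e0; rewrite add0r.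
have near1 (g : V -> R) : {for x, continuous g} -> exists2 r, 0 < r &
    forall y, `|y - x| < r -> `|g y - g x| < e / 2.
  move=> /cvgrPdist_lt /(_ (e / 2)); rewrite divr_gt0// => /(_ isT).
  move=> /nbhs_ballP [r /= r0 rP]; exists r => // y yr.
  by rewrite distrC; apply: rP; rewrite -ball_normE /= distrC.
have [r1 r10 P1] := near1 _ cF.
have [r2 r20 P2] := near1 _ cG.
pose h := Num.min r1 r2 / 2 / M.
have r0 : 0 < Num.min r1 r2 by rewrite lt_min r10.
have [|p [q [xp xq Epq]]] := close h; first by rewrite !divr_gt0.
have hM : h * M < Num.min r1 r2.
  by rewrite /h divfK ?gt_eqF// ltr_pdivrMr// mulr_natr mulr2n ltrDl.
have [rr1 rr2] : h * M < r1 /\ h * M < r2.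
  by apply/andP; rewrite -lt_min.
have := P1 _ (le_lt_trans xp rr1); rewrite Epq => pF.
have pG := P2 _ (le_lt_trans xq rr2).
rewrite (_ : F x - G x = (G q - G x) - (G q - F x)); last by ring.
by rewrite (le_trans (ler_normB _ _))// [e]splitr lerD// ltW.
Qed.

(** Both mixed derivatives compute the same second difference, each at some
    point of the small parallelogram over which the difference is taken. *)
Lemma clairaut f x u v :
  (forall y, derivable f y u) -> (forall y, derivable f y v) ->
  (forall y, derivable ('D_u f) y v) -> (forall y, derivable ('D_v f) y u) ->
  continuous ('D_v ('D_u f)) -> continuous ('D_u ('D_v f)) ->
  'D_v ('D_u f) x = 'D_u ('D_v f) x.
Proof.
move=> fu fv fuv fvu cuv cvu.
apply: (@eq_of_close _ _ x (`|u| + `|v| + 1) (cuv x) (cvu x)).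
  by rewrite ltr_wpDl// addr_ge0.
move=> h h0.
have close a b c d : 0 < c < h -> 0 < d < h -> `|a| + `|b| = `|u| + `|v| ->
    `|d *: b + (c *: a + x) - x| <= h * (`|u| + `|v| + 1).
  move=> /andP[c0 ch] /andP[d0 dh] abM.
  rewrite addrA addrK (le_trans (ler_normD _ _))// !normrZ !gtr0_norm//.
  apply: (@le_trans _ _ (h * (`|a| + `|b|))).
    by rewrite mulrDr addrC lerD// ler_wpM2r// ltW.
  by rewrite abM ler_wpM2l ?ltW// ltrDl.
have [c [d [ch dh E]]] := second_difference x h0 fu fuv.
have [c' [d' [ch' dh' E']]] := second_difference x h0 fv fvu.
exists (d *: v + (c *: u + x)), (d' *: u + (c' *: v + x)).
split; [exact: close|by apply: close => //; rewrite addrC|].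
(* Cancelling abstract reals keeps unification away from the derivatives. *)
have hI (a b : R) : h * (h * a) = h * (h * b) -> a = b.
  by have hn0 : h != 0 by [rewrite gt_eqF]; move=> /(mulfI hn0) /(mulfI hn0).
apply: (hI ('D_v ('D_u f) _) ('D_u ('D_v f) _)).
apply: etrans (esym E) _; apply: etrans _ E'.
by rewrite (addrCA (h *: u)); ring.
Qed.

End Clairaut.

(** * Partial derivatives and smoothness of complex-valued functions *)

(** The real part of the Leibniz rule for complex-valued functions a + ib and
    a' + ib'; [is_derive_mulD] is the imaginary part. *)
Lemma is_derive_mulB {R : realType} {V : normedModType R} (a b a' b' : V -> R)
    (x v : V) : derivable a x v -> derivable b x v -> derivable a' x v ->
    derivable b' x v ->
  is_derive x v (a * a' - b * b')
   (('D_v a x * a' x + a x * 'D_v a' x) - ('D_v b x * b' x + b x * 'D_v b' x)).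
Proof.
move=> /derivableP Da /derivableP Db /derivableP Da' /derivableP Db'.
have D := is_deriveB (is_deriveM Da Da') (is_deriveM Db Db').
split; first exact: (@ex_derive _ _ _ _ _ _ _ D).
rewrite (@derive_val _ _ _ _ _ _ _ D).
move: (derive a x v) (derive b x v) (derive a' x v) (derive b' x v) => *.
by rewrite /GRing.scale /=; ring.
Qed.

Lemma is_derive_mulD {R : realType} {V : normedModType R} (a b a' b' : V -> R)
    (x v : V) : derivable a x v -> derivable b x v -> derivable a' x v ->
    derivable b' x v ->
  is_derive x v (a * b' + b * a')
   (('D_v a x * b' x + b x * 'D_v a' x) + ('D_v b x * a' x + a x * 'D_v b' x)).
Proof.
move=> /derivableP Da /derivableP Db /derivableP Da' /derivableP Db'.
have D := is_deriveD (is_deriveM Da Db') (is_deriveM Db Da').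
split; first exact: (@ex_derive _ _ _ _ _ _ _ D).
rewrite (@derive_val _ _ _ _ _ _ _ D).
move: (derive a x v) (derive b x v) (derive a' x v) (derive b' x v) => *.
by rewrite /GRing.scale /=; ring.
Qed.

Section SmoothCalculus.
Context {R : realType} {d : nat}.
Implicit Types (f g : 'rV[R]_d -> R[i]) (i k : 'I_d) (c : R[i]).

Definition once_differentiable f : Prop :=
  [/\ continuous (re_part f), continuous (im_part f)
    & forall i x, derivable (re_part f) x (delta_mx 0 i) /\
                  derivable (im_part f) x (delta_mx 0 i)].

Lemma smooth_differentiable f : smooth f -> once_differentiable f.
Proof. by move=> /(_ [::]). Qed.

Lemma smooth_partial i f : smooth f -> smooth (partial i f).
Proof. by move=> fS s; have := fS (rcons s i); rewrite foldr_rcons. Qed.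

Lemma smooth_iter_partial i n f : smooth f -> smooth (iter n (partial i) f).
Proof. by move=> fS; elim: n => [//|n IH]; rewrite iterS; apply: smooth_partial. Qed.

(** Smoothness is the largest differentiable class stable under the partial
    derivatives, so exhibiting any such class proves its members smooth. *)
Lemma smooth_coind (S : ('rV[R]_d -> R[i]) -> Prop) :
  (forall f, S f -> once_differentiable f) ->
  (forall f i, S f -> S (partial i f)) -> forall f, S f -> smooth f.
Proof.
move=> SD Sp f Sf s; apply: SD; elim: s => //= i s; exact: Sp.
Qed.

Lemma laplacianE f : laplacian f = fun x => \sum_(i < d) partial i (partial i f) x.
Proof. by []. Qed.

Lemma partialC i k f : smooth f ->
  partial i (partial k f) = partial k (partial i f).
Proof.
move=> fS.
have [_ _ D] := smooth_differentiable fS.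
have [_ _ Di] := smooth_differentiable (smooth_partial i fS).
have [_ _ Dk] := smooth_differentiable (smooth_partial k fS).
have [cr ci _] := smooth_differentiable (smooth_partial i (smooth_partial k fS)).
have [cr' ci' _] := smooth_differentiable (smooth_partial k (smooth_partial i fS)).
apply/funext => x.
have Er := @clairaut R _ (re_part f) x (delta_mx 0 k) (delta_mx 0 i)
  (fun y => proj1 (D k y)) (fun y => proj1 (D i y))
  (fun y => proj1 (Dk i y)) (fun y => proj1 (Di k y)) cr cr'.
have Ei := @clairaut R _ (im_part f) x (delta_mx 0 k) (delta_mx 0 i)
  (fun y => proj2 (D k y)) (fun y => proj2 (D i y))
  (fun y => proj2 (Dk i y)) (fun y => proj2 (Di k y)) ci ci'.
exact: (f_equal2 (@Complex R) Er Ei).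
Qed.

Lemma differentiable_add f g :
  once_differentiable f -> once_differentiable g ->
  once_differentiable (fun x => f x + g x) /\
  forall i, partial i (fun x => f x + g x) =
            fun x => partial i f x + partial i g x.
Proof.
move=> [fr fi fD] [gr gi gD].
have Er : re_part (fun x => f x + g x) = re_part f + re_part g.
  by apply/funext => x; rewrite /re_part raddfD.
have Ei : im_part (fun x => f x + g x) = im_part f + im_part g.
  by apply/funext => x; rewrite /im_part raddfD.
split=> [|i]; last first.
  apply/funext => x; rewrite /partial Er Ei.
  have [? ?] := fD i x; have [? ?] := gD i x.
  by rewrite !deriveD.
split; rewrite ?Er ?Ei.
- by move=> x; apply: continuousD; [exact: fr|exact: gr].
- by move=> x; apply: continuousD; [exact: fi|exact: gi].
- move=> i x; have [? ?] := fD i x; have [? ?] := gD i x.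
  by split; apply: derivableD.
Qed.

Lemma differentiable_mul f g :
  once_differentiable f -> once_differentiable g ->
  once_differentiable (fun x => f x * g x) /\
  forall i, partial i (fun x => f x * g x) =
            fun x => partial i f x * g x + f x * partial i g x.
Proof.
move=> [fr fi fD] [gr gi gD].
have Er : re_part (fun x => f x * g x) =
    re_part f * re_part g - im_part f * im_part g.
  apply/funext => x; rewrite !fctE /re_part /im_part.
  by case: (f x) (g x) => [? ?] [? ?].
have Ei : im_part (fun x => f x * g x) =
    re_part f * im_part g + im_part f * re_part g.
  apply/funext => x; rewrite !fctE /re_part /im_part.
  by case: (f x) (g x) => [? ?] [? ?].
have Dr i x := is_derive_mulB (proj1 (fD i x)) (proj2 (fD i x))
  (proj1 (gD i x)) (proj2 (gD i x)).
have Di i x := is_derive_mulD (proj1 (fD i x)) (proj2 (fD i x))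
  (proj1 (gD i x)) (proj2 (gD i x)).
split=> [|i]; last first.
  apply/funext => x; rewrite [LHS]/partial Er Ei.
  rewrite (@derive_val _ _ _ _ _ _ _ (Dr i x)).
  rewrite (@derive_val _ _ _ _ _ _ _ (Di i x)).
  rewrite /partial /re_part /im_part.
  move: (derive _ x _) (derive _ x _) (derive _ x _) (derive _ x _) => da db da' db'.
  case: (f x) (g x) => [a b] [a' b'] /=.
  by apply/eqP; rewrite eq_complex /=; apply/andP; split; apply/eqP; ring.
split; rewrite ?Er ?Ei.
- move=> x; apply: continuousB; apply: continuousM;
  by [exact: fr|exact: gr|exact: fi|exact: gi].
- move=> x; apply: continuousD; apply: continuousM;
  by [exact: fr|exact: gr|exact: fi|exact: gi].
- by move=> i x; split; [exact: (@ex_derive _ _ _ _ _ _ _ (Dr i x))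
                       |exact: (@ex_derive _ _ _ _ _ _ _ (Di i x))].
Qed.

Lemma is_derive_coord k (v x : 'rV[R]_d) :
  is_derive x v (fun y : 'rV[R]_d => y 0 k) (v 0 k).
Proof.
(* The difference quotient of a linear form is constant off 0. *)
have E : ((h^-1 *: (((fun y : 'rV[R]_d => y 0 k) \o shift x) (h *: v) - x 0 k))
    @[h --> (0:R)^'] --> v 0 k)%classic.
  apply: cvg_near_cst.
  near=> h; rewrite /= !mxE addrK scalerA mulVf ?mul1r// /GRing.scale /= ?mul1r//.
  by near: h; exact: nbhs_dnbhs_neq.
by split; [apply/cvg_ex; exists (v 0 k)|apply: cvg_lim].
Unshelve. all: by end_near. Qed.

Lemma differentiable_cst c :
  once_differentiable (fun=> c) /\ forall i, partial i (fun=> c) = fun=> 0.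
Proof.
split=> [|i]; last first.
  apply/funext => x; rewrite /partial.
  by rewrite [X in X +i* _](@derive_cst _ _ _ (complex.Re c))
    [X in _ +i* X](@derive_cst _ _ _ (complex.Im c)).
split=> [||i x]; first exact: cst_continuous; first exact: cst_continuous.
by split; apply: derivable_cst.
Qed.

Lemma differentiable_coord k :
  once_differentiable (fun x : 'rV[R]_d => (x 0 k)%:C) /\
  forall i, partial i (fun x : 'rV[R]_d => (x 0 k)%:C) = fun=> (i == k)%:R.
Proof.
have H i x := is_derive_coord k (delta_mx 0 i) x.
split=> [|i]; last first.
  apply/funext => x; rewrite /partial.
  rewrite [X in X +i* _](@derive_val _ _ _ _ _ _ _ (H i x)).
  rewrite [X in _ +i* X](@derive_cst _ _ _ (0 : R)).
  by rewrite mxE eqxx /= eq_sym -[RHS](rmorph_nat (real_complex R)).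
split=> [||i x]; [exact: coord_continuous|exact: cst_continuous|].
by split; [exact: (@ex_derive _ _ _ _ _ _ _ (H i x))|apply: derivable_cst].
Qed.

(** The algebra generated by smooth functions and coordinates.  It is stable
    under every partial derivative by the Leibniz rule, which is what makes
    smoothness of sums and products provable by coinduction. *)
Inductive smooth_algebra : ('rV[R]_d -> R[i]) -> Prop :=
| SA_base f : smooth f -> smooth_algebra f
| SA_cst c : smooth_algebra (fun=> c)
| SA_coord k : smooth_algebra (fun x : 'rV[R]_d => (x 0 k)%:C)
| SA_add f g : smooth_algebra f -> smooth_algebra g ->
    smooth_algebra (fun x => f x + g x)
| SA_mul f g : smooth_algebra f -> smooth_algebra g ->
    smooth_algebra (fun x => f x * g x).

Lemma smooth_algebra_smooth f : smooth_algebra f -> smooth f.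
Proof.
have SD g : smooth_algebra g -> once_differentiable g.
  elim=> {g} [f0|c|k|f1 g _ Df _ Dg|f1 g _ Df _ Dg].
  - exact: smooth_differentiable.
  - by case: (differentiable_cst c).
  - by case: (differentiable_coord k).
  - by case: (differentiable_add Df Dg).
  - by case: (differentiable_mul Df Dg).
apply: smooth_coind => // {}f i.
elim=> {f} [f fS|c|k|f g Sf Pf Sg Pg|f g Sf Pf Sg Pg].
- exact/SA_base/smooth_partial.
- by case: (differentiable_cst c) => _ ->; exact: SA_cst.
- by case: (differentiable_coord k) => _ ->; exact: SA_cst.
- by case: (differentiable_add (SD _ Sf) (SD _ Sg)) => _ ->; exact: SA_add.
- case: (differentiable_mul (SD _ Sf) (SD _ Sg)) => _ ->.
  by apply: SA_add; apply: SA_mul.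
Qed.

Lemma smooth_cst c : smooth (fun _ : 'rV[R]_d => c).
Proof. exact/smooth_algebra_smooth/SA_cst. Qed.

Lemma smooth_coord k : smooth (fun x : 'rV[R]_d => (x 0 k)%:C).
Proof. exact/smooth_algebra_smooth/SA_coord. Qed.

Lemma smooth_add f g : smooth f -> smooth g -> smooth (fun x => f x + g x).
Proof. by move=> *; apply/smooth_algebra_smooth/SA_add; exact: SA_base. Qed.

Lemma smooth_mul f g : smooth f -> smooth g -> smooth (fun x => f x * g x).
Proof. by move=> *; apply/smooth_algebra_smooth/SA_mul; exact: SA_base. Qed.

Lemma smooth_scale c f : smooth f -> smooth (fun x => c * f x).
Proof. exact/smooth_mul/smooth_cst. Qed.

Lemma big_nil_fun (I T : Type) (F : I -> T -> R[i]) :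
  (fun x => \sum_(j <- [::]) F j x) = fun=> 0.
Proof. by apply/funext => x; rewrite big_nil. Qed.

Lemma big_cons_fun (I T : Type) j (r : seq I) (F : I -> T -> R[i]) :
  (fun x => \sum_(l <- j :: r) F l x) = fun x => F j x + \sum_(l <- r) F l x.
Proof. by apply/funext => x; rewrite big_cons. Qed.

Lemma smooth_sum (I : Type) (r : seq I) (F : I -> 'rV[R]_d -> R[i]) :
  (forall j, smooth (F j)) -> smooth (fun x => \sum_(j <- r) F j x).
Proof.
move=> FS; elim: r => [|j r IH].
  by rewrite big_nil_fun; exact: smooth_cst.
by rewrite big_cons_fun; exact: (smooth_add (FS j) IH).
Qed.

Lemma partial_add i f g : smooth f -> smooth g ->
  partial i (fun x => f x + g x) = fun x => partial i f x + partial i g x.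
Proof.
by move=> /smooth_differentiable Df /smooth_differentiable Dg;
  case: (differentiable_add Df Dg) => _ ->.
Qed.

Lemma partial_mul i f g : smooth f -> smooth g ->
  partial i (fun x => f x * g x) =
  fun x => partial i f x * g x + f x * partial i g x.
Proof.
by move=> /smooth_differentiable Df /smooth_differentiable Dg;
  case: (differentiable_mul Df Dg) => _ ->.
Qed.

Lemma partial_scale i c f : smooth f ->
  partial i (fun x => c * f x) = fun x => c * partial i f x.
Proof.
move=> fS; rewrite (partial_mul i (smooth_cst c) fS).
case: (differentiable_cst c) => _ ->.
by apply/funext => x; rewrite mul0r add0r.
Qed.

Lemma partial_coord_mul i k f : smooth f ->
  partial i (fun x => (x 0 k)%:C * f x) =
  fun x => (i == k)%:R * f x + (x 0 k)%:C * partial i f x.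
Proof.
move=> fS; rewrite (partial_mul i (smooth_coord k) fS).
by case: (differentiable_coord k) => _ ->.
Qed.

Lemma partial_sum (I : Type) (r : seq I) i (F : I -> 'rV[R]_d -> R[i]) :
  (forall j, smooth (F j)) ->
  partial i (fun x => \sum_(j <- r) F j x) =
  fun x => \sum_(j <- r) partial i (F j) x.
Proof.
move=> FS; elim: r => [|j r IH].
  rewrite !big_nil_fun.
  by case: (differentiable_cst 0) => _ ->.
rewrite !big_cons_fun.
by rewrite (partial_add i (FS j) (smooth_sum r FS)) IH.
Qed.

Lemma smooth_laplacian f : smooth f -> smooth (laplacian f).
Proof.
by move=> fS; rewrite laplacianE; apply: smooth_sum => i; do 2!apply: smooth_partial.
Qed.

Lemma smooth_iter_laplacian n f : smooth f -> smooth (iter n laplacian f).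
Proof. by move=> fS; elim: n => [//|n IH]; rewrite iterS; apply: smooth_laplacian. Qed.

Lemma laplacian_add f g : smooth f -> smooth g ->
  laplacian (fun x => f x + g x) = fun x => laplacian f x + laplacian g x.
Proof.
move=> fS gS; apply/funext => x; rewrite !laplacianE -big_split /=.
apply: eq_bigr => i _; rewrite (partial_add i fS gS).
by rewrite (partial_add i (smooth_partial i fS) (smooth_partial i gS)).
Qed.

Lemma laplacian_scale c f : smooth f ->
  laplacian (fun x => c * f x) = fun x => c * laplacian f x.
Proof.
move=> fS; apply/funext => x; rewrite !laplacianE mulr_sumr.
apply: eq_bigr => i _; rewrite (partial_scale i c fS).
by rewrite (partial_scale i c (smooth_partial i fS)).
Qed.

Lemma iter_laplacian_lin n a b f g : smooth f -> smooth g ->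
  iter n laplacian (fun x => a * f x + b * g x) =
  fun x => a * iter n laplacian f x + b * iter n laplacian g x.
Proof.
move=> fS gS; elim: n => [//|n IH]; rewrite iterS IH.
have fnS := smooth_iter_laplacian n fS; have gnS := smooth_iter_laplacian n gS.
rewrite (laplacian_add (smooth_scale a fnS) (smooth_scale b gnS)).
by rewrite (laplacian_scale a fnS) (laplacian_scale b gnS).
Qed.

Lemma partial_laplacian i f : smooth f ->
  partial i (laplacian f) = laplacian (partial i f).
Proof.
move=> fS; rewrite !laplacianE.
rewrite (partial_sum _ i (fun k => smooth_partial k (smooth_partial k fS))).
apply/funext => x; apply: eq_bigr => k _.
by rewrite (partialC i k (smooth_partial k fS)) (partialC i k fS).
Qed.

Lemma iter_partial_laplacian i n f : smooth f ->
  iter n (partial i) (laplacian f) = laplacian (iter n (partial i) f).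
Proof.
move=> fS; elim: n => [//|n IH]; rewrite iterS IH.
exact: (partial_laplacian i (smooth_iter_partial i n fS)).
Qed.

End SmoothCalculus.

(** * Restriction to the hyperplane and jets *)

(* The imports give the bare name another meaning. *)
Local Notation restrict := Defs.restrict.

Section Restriction.
Context {R : realType} {m : nat}.
Implicit Types (f g : 'rV[R]_m.+1 -> R[i]) (x : 'rV[R]_m) (i : 'I_m).

Lemma embed_shift i (h : R) x :
  embed (h *: delta_mx 0 i + x) = h *: delta_mx 0 (lift ord_max i) + embed x.
Proof.
apply/rowP => j; rewrite !mxE; case: unliftP => [l ->|->].
  by rewrite !mxE (inj_eq (@lift_inj _ _)).
by rewrite (negbTE (neq_lift _ _)) andbF mulr0 addr0.
Qed.

Lemma continuous_embed : continuous (@embed R m).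
Proof.
move=> x s /nbhs_ballP[e e0 es]; apply/nbhs_ballP; exists e => // y xy.
apply: es; split=> // a b; rewrite !mxE.
by case: unliftP => [l _|_]; [exact: (proj2 xy)|exact: ballxx].
Qed.

(** Restriction commutes with tangential derivatives because the difference
    quotients agree term by term. *)
Lemma difference_quotient_embed (g : 'rV[R]_m.+1 -> R) i x :
  (fun h : R => h^-1 *: (((g \o embed) \o shift x) (h *: delta_mx 0 i)
                        - (g \o embed) x)) =
  (fun h : R => h^-1 *: ((g \o shift (embed x))
                          (h *: delta_mx 0 (lift ord_max i)) - g (embed x))).
Proof. by apply/funext => h /=; rewrite embed_shift. Qed.

Lemma derive_embed (g : 'rV[R]_m.+1 -> R) i x :
  'D_(delta_mx 0 i) (g \o embed) x =
  'D_(delta_mx 0 (lift ord_max i)) g (embed x).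
Proof. by rewrite /derive difference_quotient_embed. Qed.

Lemma derivable_embed (g : 'rV[R]_m.+1 -> R) i x :
  derivable g (embed x) (delta_mx 0 (lift ord_max i)) ->
  derivable (g \o embed) x (delta_mx 0 i).
Proof. by rewrite /derivable difference_quotient_embed. Qed.

Lemma partial_restrict i f :
  partial i (restrict f) = restrict (partial (lift ord_max i) f).
Proof.
apply/funext => x.
exact: (f_equal2 (@Complex R) (derive_embed (re_part f) i x)
                              (derive_embed (im_part f) i x)).
Qed.

Lemma differentiable_restrict f :
  once_differentiable f -> once_differentiable (restrict f).
Proof.
move=> [fr fi fD]; split.
- by move=> x; exact: (@continuous_comp _ _ _ embed (re_part f) x (@continuous_embed x) (fr _)).
- by move=> x; exact: (@continuous_comp _ _ _ embed (im_part f) x (@continuous_embed x) (fi _)).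
- move=> i x; have [Dr Di] := fD (lift ord_max i) (embed x).
  exact: (conj (derivable_embed Dr) (derivable_embed Di)).
Qed.

Lemma smooth_restrict f : smooth f -> smooth (restrict f).
Proof.
move=> fS.
refine (@smooth_coind R m (fun u => exists2 h, smooth h & u = restrict h) _ _ _ _);
  last by exists f.
- by move=> _ [h /smooth_differentiable hD ->]; exact: differentiable_restrict.
- move=> _ i [h hS ->]; rewrite partial_restrict.
  by exists (partial (lift ord_max i) h); [exact: (smooth_partial _ hS)|].
Qed.

Lemma restrict_laplacian f :
  restrict (laplacian f) =
  fun x => laplacian (restrict f) x
           + restrict (partial ord_max (partial ord_max f)) x.
Proof.
apply/funext => x.
have L : restrict (laplacian f) x =
    \sum_(i < m.+1) partial i (partial i f) (embed x) by [].
have W i : widen_ord (leqnSn m) i = lift ord_max i.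
  by apply/val_inj; rewrite /= /bump leqNgt ltn_ord.
have E i : partial i (partial i (restrict f)) x =
    partial (lift ord_max i) (partial (lift ord_max i) f) (embed x).
  by rewrite !partial_restrict.
rewrite L big_ord_recr laplacianE.
under [in RHS]eq_bigr do rewrite E -W.
exact: erefl.
Qed.

Definition jet j k f : 'rV[R]_m -> R[i] :=
  iter j laplacian (restrict (iter k (partial ord_max) f)).

Lemma smooth_Pop mu f : smooth f -> smooth (Pop mu f).
Proof.
move=> fS.
have S1 := smooth_mul (smooth_coord ord_max) (smooth_laplacian fS).
have := smooth_add S1
  (smooth_scale (- (2 * mu - m.+1%:R - 2)) (smooth_partial ord_max fS)).
by congr smooth; apply/funext => x; rewrite /Pop mulNr.
Qed.

(** The k-th derivative of x_n g is x_n times that of g plus k times the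
    previous one: x_n is linear, so Leibniz stops after one term. *)
Lemma iter_partial_Pop k mu f : smooth f ->
  iter k (partial ord_max) (Pop mu f) = fun y =>
    (y 0 ord_max)%:C * iter k (partial ord_max) (laplacian f) y
    + (k%:R * iter k.-1 (partial ord_max) (laplacian f) y
       + (- (2 * mu - m.+1%:R - 2)) * iter k.+1 (partial ord_max) f y).
Proof.
move=> fS; set c := - _; set dn := partial ord_max.
have gS n := smooth_iter_partial ord_max n (smooth_laplacian fS).
have hS n := smooth_iter_partial ord_max n fS.
elim: k => [|k IH].
  by apply/funext => y; rewrite /= mul0r add0r /Pop /c mulNr.
rewrite iterS IH.
have cS := smooth_scale c (hS k.+1); have kS := smooth_scale k%:R (gS k.-1).
rewrite /dn (partial_add ord_max (smooth_mul (smooth_coord ord_max) (gS k))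
  (smooth_add kS cS)) (partial_add ord_max kS cS).
rewrite (partial_coord_mul ord_max ord_max (gS k)).
rewrite (partial_scale ord_max c (hS k.+1)).
rewrite (partial_scale ord_max k%:R (gS k.-1)).
apply/funext => y; rewrite eqxx mul1r.
(* For k = 0 the predecessor is 0 and the coefficient vanishes. *)
have -> : k%:R * partial ord_max
    (iter k.-1 (partial ord_max) (laplacian f)) y =
    k%:R * iter k (partial ord_max) (laplacian f) y.
  by case: (k) => [|k'] //; rewrite !mul0r.
rewrite -!iterS /= -natr1.
move: (partial _ (iter k _ (laplacian f)) y) (iter k _ (laplacian f) y) => a b.
by move: (partial _ _ y) => e; ring.
Qed.

(** On the hyperplane the term carrying x_n disappears, and the ambient
    Laplacian splits as Delta' + d_n^2. *)
Lemma jet_Pop j k mu f : smooth f ->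
  jet j k (Pop mu f) = fun x =>
    k%:R * jet j.+1 k.-1 f x
    + (k%:R - (2 * mu - m.+1%:R - 2)) * jet j k.+1 f x.
Proof.
move=> fS; rewrite /jet iterSr.
have hS n := smooth_iter_partial ord_max n fS.
set c := k%:R - _.
rewrite -(iter_laplacian_lin j k%:R c
  (smooth_laplacian (smooth_restrict (hS k.-1))) (smooth_restrict (hS k.+1))).
congr (iter j laplacian _); rewrite (iter_partial_Pop k mu fS).
rewrite (iter_partial_laplacian ord_max k fS).
rewrite (iter_partial_laplacian ord_max k.-1 fS).
apply/funext => x; rewrite {1}/restrict.
have -> : embed x 0 ord_max = 0 by rewrite mxE unlift_none.
rewrite mul0r add0r.
have := congr1 (fun u => u x) (restrict_laplacian (iter k.-1 (partial ord_max) f)).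
rewrite {1}/restrict => ->.
rewrite -!iterS mulrDr -addrA; congr (_ + _).
(* The same truncation at k = 0 as in the previous lemma. *)
have -> : k%:R * restrict (iter k.-1.+2 (partial ord_max) f) x =
    k%:R * restrict (iter k.+1 (partial ord_max) f) x.
  by case: (k) => [|k'] //; rewrite !mul0r.
exact: (esym (mulrDl _ _ _)).
Qed.

End Restriction.

(** * The coefficient recursion and its solution *)

Section Coefficients.
Context {K : numFieldType}.
Implicit Types (A : K) (M N k : nat).

(** The recursion satisfied by the coefficient of the jet of tangential order k
    in the composition of M factors.  The differences under the casts are
    truncated, which is harmless: the terms where this happens vanish. *)
Fixpoint bs_coef M k A : K :=
  if M is M'.+1 then
    ((M' - 2 * k)%:R - A) * bs_coef M' k (A - 2)
    + (if k is k'.+1 then (M' - 2 * k')%:R * bs_coef M' k' (A - 2) else 0)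
  else (k == 0)%:R.

Lemma bs_coef_eq0 M k A : (M < 2 * k)%N -> bs_coef M k A = 0.
Proof.
elim: M k A => [|M IH] [|k] A //= Mk.
rewrite IH ?mulr0 ?add0r; last by lia.
by rewrite (_ : M - 2 * k = 0)%N ?mul0r//; lia.
Qed.

Definition bs_factor M k A : K :=
  \prod_(0 <= i < M | ~~ (odd i && (i < 2 * k)%N))
    ((2 * M)%:R - 2 - i%:R - A).

(** The product depends on M and A only through 2M - A, up to its range: passing
    from (M, A - 2) to (M + 1, A) therefore only adds the factor i = M. *)
Lemma bs_factor_rec M k A : bs_factor M.+1 k A =
  bs_factor M k (A - 2) * (if odd M && (M < 2 * k)%N then 1 else M%:R - A).
Proof.
rewrite /bs_factor big_mkcond big_nat_recr //= [in RHS]big_mkcond /=.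
congr (_ * _).
  by apply: eq_bigr => i _; case: ifP => // _; rewrite !natrM -natr1; ring.
by case: ifP; case: ifP => //= _ _; rewrite natrM -natr1; ring.
Qed.

Lemma bs_factor_drop M k A : ((2 * k).+1 < M)%N ->
  bs_factor M k A =
  bs_factor M k.+1 A * ((2 * M)%:R - 2 - (2 * k).+1%:R - A).
Proof.
move=> kM; rewrite /bs_factor big_mkcond [in RHS]big_mkcond /=.
have kI : (2 * k).+1 \in index_iota 0 M by rewrite mem_index_iota.
rewrite (bigD1_seq (2 * k).+1) ?iota_uniq//=.
rewrite [in RHS](bigD1_seq (2 * k).+1) ?iota_uniq//=.
rewrite ifT; last by lia.
rewrite [in RHS]ifF; last by lia.
rewrite mul1r mulrC; congr (_ * _); apply: eq_bigr => i ik.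
by congr (if _ then _ else _); move: ik; lia.
Qed.

Lemma bs_factor_top M k A : (M <= (2 * k).+1)%N ->
  bs_factor M k A = bs_factor M k.+1 A.
Proof.
move=> kM; rewrite /bs_factor; apply: congr_big_nat => // i; lia.
Qed.

(** The number of ways to choose k disjoint pairs among M points. *)
Definition bs_mult M k : K := M`!%:R / (k`! * (M - 2 * k)`! * 2 ^ k)%:R.

(** By induction on M.  After cancelling common factors, the step from M to
    M + 1 at an index k with 2k <= M is the polynomial identity
    (M+1)(M - A) = (M - 2k - A)(M + 1 - 2k) + 2k(2M + 1 - 2k - A).
    When 2k = M + 1 only the term of index k - 1 survives. *)
Lemma bs_coefE M k A : (2 * k <= M)%N ->
  bs_coef M k A = bs_mult M k * bs_factor M k A.
Proof.
have fN0 n : (n`!%:R : K) != 0 by rewrite pnatr_eq0 -lt0n fact_gt0.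
have pN0 n : ((2 : K) ^+ n) != 0 by rewrite expf_neq0// pnatr_eq0.
have sN0 n : (1 + n%:R : K) != 0 by rewrite addrC natr1 pnatr_eq0.
elim: M k A => [|M IH] k A kM.
  have -> : k = 0%N by lia.
  by rewrite /bs_mult /bs_factor big_nil /= mulr1 invr1 mulr1.
case: k kM => [_|k kM].
  rewrite /= addr0 IH// bs_factor_rec andbF subn0 /bs_mult.
  rewrite !fact0 !expn0 !muln0 !subn0 !mul1n !muln1 !divff//.
  by rewrite !mul1r mulrC.
rewrite bs_factor_rec [LHS]/=.
have [kM'|Mk] := leqP (2 * k.+1) M.
  rewrite andbF !IH//; last by lia.
  rewrite (bs_factor_drop (k := k)); last by lia.
  (* With M = 2(k+1) + r all factorials are multiples of k!, r! and M!. *)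
  have [r EM] : exists r, M = (2 * k.+1 + r)%N by exists (M - 2 * k.+1)%N; lia.
  rewrite /bs_mult (_ : (M - 2 * k.+1 = r)%N); last by lia.
  rewrite (_ : (M - 2 * k = r.+2)%N); last by lia.
  rewrite (_ : (M.+1 - 2 * k.+1 = r.+1)%N); last by lia.
  rewrite !factS !natrM !natrX exprS.
  have EMK : (M%:R : K) = 2 * (1 + k%:R) + r%:R by rewrite EM natrD natrM -natr1; ring.
  move: (pN0 k); move: (2 ^+ k) => e e0.
  rewrite -!natr1 !natrM EMK.
  move: (bs_factor _ _ _) (fN0 r) (fN0 k) (sN0 k) (sN0 r) (sN0 r.+1).
  rewrite -natr1.
  move: (M`!%:R) (k`!%:R) (r`!%:R) (k%:R) (r%:R) => a b c kk rr G b0 c0 s1 s2 s3.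
  field.
  rewrite b0 c0 e0 /=; apply/and3P; split; [move: s2|move: s1|move: s3];
    apply: contra_neq => <-; ring.
rewrite bs_coef_eq0// mulr0 add0r IH; last by lia.
have EM : M = (2 * k).+1 by lia.
rewrite andbT (_ : odd M = true); last by lia.
rewrite mulr1 (bs_factor_top (k := k)); last by lia.
rewrite mulrA; congr (_ * _); rewrite /bs_mult.
rewrite (_ : (M - 2 * k = 1)%N); last by lia.
rewrite (_ : (M.+1 - 2 * k.+1 = 0)%N); last by lia.
rewrite mul1r !factS fact0 !natrM !natrX exprS.
have EMK : (M%:R : K) = 2 * k%:R + 1 by rewrite EM -natr1 natrM.
move: (pN0 k); move: (2 ^+ k) => e e0.
rewrite -!natr1 EMK.
move: (fN0 k) (sN0 k).
move: (M`!%:R) (k`!%:R) (k%:R) => a b kk b0 s1.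
field; rewrite b0 e0 /=; move: s1.
by apply: contra_neq => <-; ring.
Qed.

Lemma prod_double (G : nat -> K) N :
  \prod_(0 <= i < 2 * N) G i =
  \prod_(0 <= i < N) G (2 * i)%N * \prod_(0 <= i < N) G (2 * i).+1.
Proof.
elim: N => [|N IH]; first by rewrite !big_nil mulr1.
rewrite (_ : (2 * N.+1 = (2 * N).+2)%N); last by lia.
by rewrite !big_nat_recr//= IH; ring.
Qed.

Lemma prod_from (G : nat -> K) k N :
  \prod_(0 <= j < N) (if (k <= j)%N then G j else 1) = \prod_(k <= j < N) G j.
Proof.
by rewrite -big_mkcond /= (big_nat_widenl k 0).
Qed.

Lemma bs_factor_even N k A :
  bs_factor (2 * N) k A =
  \prod_(0 <= i < N) (4 * N%:R - 2 - 2 * i%:R - A)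
  * \prod_(k <= j < N) (4 * N%:R - 3 - 2 * j%:R - A).
Proof.
rewrite /bs_factor big_mkcond /= prod_double; congr (_ * _).
  apply: eq_bigr => i _; rewrite ifT; last by lia.
  by rewrite !natrM; ring.
rewrite -[RHS]prod_from; apply: eq_bigr => i _.
rewrite (_ : ~~ _ = (k <= i)%N); last by lia.
by case: ifP => // _; rewrite -natr1 !natrM; ring.
Qed.

Lemma bs_factor_odd N k A : (k <= N)%N ->
  bs_factor (2 * N).+1 k A =
  \prod_(0 <= i < N.+1) (4 * N%:R - 2 * i%:R - A)
  * \prod_(k <= j < N) (4 * N%:R - 1 - 2 * j%:R - A).
Proof.
move=> kN; rewrite /bs_factor big_mkcond /= big_nat_recr//= prod_double.
rewrite [in RHS]big_nat_recr//= mulrAC; congr (_ * _ * _).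
- apply: eq_bigr => i _; rewrite ifT; last by lia.
  by rewrite natrM -natr1 !natrM; ring.
- rewrite ifT; last by lia.
  by rewrite natrM -natr1 !natrM; ring.
- rewrite -[RHS]prod_from; apply: eq_bigr => i _.
  rewrite (_ : ~~ _ = (k <= i)%N); last by lia.
  by case: ifP => // _; rewrite natrM -!natr1 !natrM; ring.
Qed.

Lemma fact_odd N :
  ((2 * N + 1)`! = double_fact (2 * N + 1) * (2 ^ N * N`!))%N.
Proof.
elim: N => [//|N IH].
rewrite (_ : 2 * N.+1 + 1 = (2 * N + 1).+2)%N; last by lia.
rewrite 2!factS IH [double_fact _.+2]/= !factS expnS.
by move: (double_fact _) => D; ring.
Qed.

Lemma fact_even N : ((2 * N)`! = double_fact (2 * N - 1) * (2 ^ N * N`!))%N.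
Proof.
case: N => [//|N].
rewrite (_ : 2 * N.+1 = (2 * N + 1).+1)%N; last by lia.
rewrite subn1 factS fact_odd !factS expnS /=.
by move: (double_fact _) => D; ring.
Qed.

End Coefficients.

(** * Closed forms of the Bernstein-Sato family *)

Section ClosedForm.
Context {R : realType} {m : nat}.
Implicit Types (lambda : R[i]) (f : 'rV[R]_m.+1 -> R[i]).
Local Notation n := (m.+1%:R : R[i]).

(** The chain is defined by adding outer factors; the induction on jets peels
    off the inner one, which acts directly on f. *)
Lemma Pchain_recr N lambda f :
  Pchain N.+1 lambda f = Pchain N (lambda - 1) (Pop lambda f).
Proof.
elim: N => [|N IH]; first by rewrite /= subr0.
have -> : Pchain N.+2 lambda f =
    Pop (lambda - N.+1%:R) (Pchain N.+1 lambda f) by [].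
rewrite IH (_ : lambda - N.+1%:R = lambda - 1 - N%:R)//.
by rewrite -natr1 opprD addrA addrAC.
Qed.

(** Induction on N through [jet_Pop]: the two terms of the jet of P(lambda) f
    are the two terms of the recursion for [bs_coef]. *)
Lemma DBS_jet N lambda f : smooth f ->
  DBS N lambda f = fun x =>
    \sum_(0 <= k < N.+1)
      bs_coef N k (2 * lambda - n - 2) * jet k (N - 2 * k) f x.
Proof.
elim: N lambda f => [|N IH] lambda f fS; apply/funext => x.
  by rewrite big_nat1 mul1r.
have -> : DBS N.+1 lambda f = DBS N (lambda - 1) (Pop lambda f).
  by rewrite /DBS Pchain_recr.
rewrite (IH _ _ (smooth_Pop lambda fS)).
set A := 2 * lambda - n - 2.
rewrite (_ : 2 * (lambda - 1) - n - 2 = A - 2); last by rewrite /A; ring.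
pose t1 k := ((N - 2 * k)%:R - A) * bs_coef N k (A - 2)
             * jet k (N.+1 - 2 * k) f x.
pose t2 k := (N - 2 * k)%:R * bs_coef N k (A - 2)
             * jet k.+1 (N.+1 - 2 * k.+1) f x.
transitivity (\sum_(0 <= k < N.+1) (t1 k + t2 k)).
  apply: eq_bigr => k _; rewrite (jet_Pop k (N - 2 * k) lambda fS) /t1 /t2.
  rewrite (_ : (N - 2 * k).-1 = N.+1 - 2 * k.+1)%N; last by lia.
  have [kN|Nk] := leqP (2 * k) N; last by rewrite bs_coef_eq0// !(mul0r, mulr0) addr0.
  rewrite (_ : (N - 2 * k).+1 = N.+1 - 2 * k)%N; last by lia.
  rewrite -/A; move: (jet _ _ _ _) (jet _ _ _ _) (bs_coef _ _ _) => u v c.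
  by ring.
(* Aligning both sums needs one extra term of the first and a shift of the
   second. *)
have t1N : t1 N.+1 = 0 by rewrite /t1 bs_coef_eq0 ?(mulr0, mul0r)//; lia.
rewrite big_split /=.
have -> : \sum_(0 <= k < N.+1) t1 k = \sum_(0 <= k < N.+2) t1 k.
  by rewrite [RHS]big_nat_recr//= t1N addr0.
rewrite [in LHS](big_nat_recl N.+1)// [RHS]big_nat_recl//.
rewrite -(addrA (t1 0%N)) -big_split /=; congr (_ + _).
  by rewrite addr0.
by apply: eq_bigr => k _; exact: (esym (mulrDl _ _ _)).
Qed.

Lemma prod_pochhammer (K : numFieldType) (a : K) N :
  (-2) ^+ N * pochhammer a N = \prod_(0 <= i < N) (-2 * (a + i%:R)).
Proof.
by rewrite big_mkord big_split /= prodr_const card_ord.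
Qed.

Lemma prod_oppr_nat (K : numFieldType) (G : nat -> K) k N :
  \prod_(k <= j < N) - G j = (-1) ^+ (N - k) * \prod_(k <= j < N) G j.
Proof.
rewrite -prodr_const_nat -big_split /=.
by apply: eq_bigr => j _; rewrite mulN1r.
Qed.

(** Here D is the double factorial, with M = 2N or 2N + 1; the sign and the
    power of 2 are those of the coefficients a and b. *)
Lemma bs_mult_double_fact (K : numFieldType) M N k D : (k <= N)%N ->
  M`! = (D * (2 ^ N * N`!))%N ->
  bs_mult M k * (-1) ^+ (N - k) =
  D%:R * ((-2) ^+ (N - k) * N`!%:R / (k`! * (M - 2 * k)`!)%:R) :> K.
Proof.
move=> kN EM; rewrite /bs_mult EM -{1}(subnK kN) expnD !natrM !natrX.
rewrite [(-2) ^+ _]exprNn.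
have fN0 i : (i`!%:R : K) != 0 by rewrite pnatr_eq0 -lt0n fact_gt0.
have pN0 : ((2 : K) ^+ k) != 0 by rewrite expf_neq0// pnatr_eq0.
move: (fN0 k) (fN0 (M - 2 * k)%N) pN0.
move: ((2 : K) ^+ k) ((2 : K) ^+ _) ((-1 : K) ^+ _) (k`!%:R : K)
  ((M - _)`!%:R : K) => a b c d e d0 e0 a0.
by field; rewrite a0 d0 e0.
Qed.

(** The shape shared by the even and odd closed forms: P is the Pochhammer
    product and Q the product in the coefficient a or b. *)
Lemma regroup (K : comNzRingType) (b c D X P Q : K) :
  b * c = D * X -> b * (P * (c * Q)) = P * D * (X * Q).
Proof.
move=> E; have -> : b * (P * (c * Q)) = P * (b * c) * Q by ring.
by rewrite E; ring.
Qed.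

Lemma bs_coef_even N k lambda : (k <= N)%N ->
  bs_coef (2 * N) k (2 * lambda - n - 2) =
  (-2) ^+ N * pochhammer (lambda - n / 2 - 2 * N%:R) N
  * (double_fact (2 * N - 1))%:R * @coef_a R m N k (- (n - lambda)).
Proof.
move=> kN; rewrite bs_coefE; last by lia.
rewrite bs_factor_even prod_pochhammer /coef_a.
have -> : \prod_(0 <= i < N) (-2 * (lambda - n / 2 - 2 * N%:R + i%:R)) =
    \prod_(0 <= i < N) (4 * N%:R - 2 - 2 * i%:R - (2 * lambda - n - 2)).
  by apply: eq_bigr => i _; field.
have -> : \prod_(k <= j < N) (4 * N%:R - 3 - 2 * j%:R - (2 * lambda - n - 2)) =
    (-1) ^+ (N - k) * \prod_(k <= j < N)
      (2 * (- (n - lambda)) - 4 * N%:R + 2 * j%:R + n + 1).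
  by rewrite -prod_oppr_nat; apply: eq_bigr => j _; ring.
exact: (regroup _ _ (bs_mult_double_fact R[i] kN (fact_even N))).
Qed.

Lemma bs_coef_odd N k lambda : (k <= N)%N ->
  bs_coef (2 * N + 1) k (2 * lambda - n - 2) =
  (-2) ^+ N.+1 * pochhammer (lambda - n / 2 - 2 * N%:R - 1) N.+1
  * (double_fact (2 * N + 1))%:R * @coef_b R m N k (- (n - lambda)).
Proof.
move=> kN; rewrite bs_coefE; last by lia.
rewrite {2}addn1 bs_factor_odd// prod_pochhammer /coef_b.
have -> : \prod_(0 <= i < N.+1) (-2 * (lambda - n / 2 - 2 * N%:R - 1 + i%:R)) =
    \prod_(0 <= i < N.+1) (4 * N%:R - 2 * i%:R - (2 * lambda - n - 2)).
  by apply: eq_bigr => i _; field.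
have -> : \prod_(k <= j < N) (4 * N%:R - 1 - 2 * j%:R - (2 * lambda - n - 2)) =
    (-1) ^+ (N - k) * \prod_(k <= j < N)
      (2 * (- (n - lambda)) - 4 * N%:R + 2 * j%:R + n - 1).
  by rewrite -prod_oppr_nat; apply: eq_bigr => j _; ring.
have := bs_mult_double_fact R[i] kN (fact_odd N).
rewrite (_ : 2 * N + 1 - 2 * k = 2 * N - 2 * k + 1)%N; last by lia.
exact: regroup.
Qed.

Lemma DBS_jet_half M N lambda f : smooth f -> N = M./2 ->
  DBS M lambda f = fun x =>
    \sum_(k < N.+1) bs_coef M k (2 * lambda - n - 2) * jet k (M - 2 * k) f x.
Proof.
move=> fS NM; rewrite (DBS_jet M lambda fS); apply/funext => x.
rewrite -(big_mkord xpredT (fun k =>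
  bs_coef M k (2 * lambda - n - 2) * jet k (M - 2 * k) f x)).
rewrite (@big_cat_nat _ _ _ N.+1)//=; last by lia.
rewrite [X in _ + X]big_nat_cond [X in _ + X]big1 ?addr0// => k.
by rewrite andbT => /andP[Nk _]; rewrite bs_coef_eq0 ?mul0r//; lia.
Qed.

Lemma smooth_DBS M lambda f : smooth f -> smooth (DBS M lambda f).
Proof.
move=> fS; apply: smooth_restrict; elim: M => [|M IH]; first exact: fS.
exact: (smooth_Pop _ IH).
Qed.

End ClosedForm.

Theorem theorem4p2 (R : realType) (m : nat) (hn : (2 <= m.+1)%N)
    (N : nat) (lambda : R[i]) :
  let n : R[i] := m.+1%:R in
  eq_smooth_op (m := m) (DBS (2 * N) lambda)
    (fun f x =>
       (-2) ^+ N * pochhammer (lambda - n / 2 - 2 * N%:R) N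
       * (double_fact (2 * N - 1))%:R * Deven N (n - lambda) f x)
  /\
  eq_smooth_op (m := m) (DBS (2 * N + 1) lambda)
    (fun f x =>
       (-2) ^+ N.+1 * pochhammer (lambda - n / 2 - 2 * N%:R - 1) N.+1
       * (double_fact (2 * N + 1))%:R * Dodd N (n - lambda) f x).
Proof.
move=> n; split=> f fS.
  have E : DBS (2 * N) lambda f = fun x : 'rV[R]_m =>
      (-2) ^+ N * pochhammer (lambda - n / 2 - 2 * N%:R) N
      * (double_fact (2 * N - 1))%:R * Deven N (n - lambda) f x.
    rewrite (@DBS_jet_half _ _ _ N _ _ fS); last by lia.
    apply/funext => x; rewrite /Deven mulr_sumr; apply: eq_bigr => k _.
    have kN : (k <= N)%N by rewrite -ltnS ltn_ord.
    rewrite (bs_coef_even _ kN) -[LHS]mulrA; reflexivity.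
  have S := smooth_DBS (2 * N) lambda fS.
  by split; [exact: S|rewrite -E; exact: S|exact: E].
have E : DBS (2 * N + 1) lambda f = fun x : 'rV[R]_m =>
    (-2) ^+ N.+1 * pochhammer (lambda - n / 2 - 2 * N%:R - 1) N.+1
    * (double_fact (2 * N + 1))%:R * Dodd N (n - lambda) f x.
  rewrite (@DBS_jet_half _ _ _ N _ _ fS); last by lia.
  apply/funext => x; rewrite /Dodd mulr_sumr; apply: eq_bigr => k _.
  have kN : (k <= N)%N by rewrite -ltnS ltn_ord.
  rewrite (bs_coef_odd _ kN) -[LHS]mulrA.
  rewrite (_ : 2 * N + 1 - 2 * k = 2 * N - 2 * k + 1)%N; last by lia.
  reflexivity.
have S := smooth_DBS (2 * N + 1) lambda fS.
by split; [exact: S|rewrite -E; exact: S|exact: E].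
Qed.
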